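(* Let $E$ be a real Banach space, let $S=\{S(t)\}_{t\ge 0}$ be a $C_0$-semigroup on $E$ with generator $A$, let $B$ be a bounded linear operator from a real Hilbert space $H$ into $E$, let $P$ be the associated Ornstein-Uhlenbeck semigroup and $P^\circ$ its restriction to $BUC^\circ(E)$. For all $t,s\ge 0$ such that $S(t)\neq S(s)$ we have $$\|P^\circ(t)-P^\circ(s)\|_{\mathcal{L}(BUC^\circ(E))}=2.$$
   Context: Setting. $E^*$ is the dual of $E$; $Q:=BB^*\in\mathcal{L}(E^*,E)$ (with $H$ identified with its dual). For $t\ge 0$, $Q_t\in\mathcal{L}(E^*,E)$ is given by $\langle Q_tx^*,y^*\rangle=\int_0^t\langle S(s)BB^*S^*(s)x^*,y^*\rangle\,ds$ for $x^*,y^*\in E^*$. Standing assumption: for each $t\ge 0$ there is a centred Gaussian Radon measure $\mu_t$ on $E$ with covariance operator $Q_t$, i.e. a Radon probability measure under which every $x^*\in E^*$ is a centred Gaussian random variable with variance $\langle Q_tx^*,x^*\rangle$ (so $\mu_0=\delta_0$). The Ornstein-Uhlenbeck semigroup is $P(t)f(x)=\int_E f(S(t)x+y)\,d\mu_t(y)$ for bounded real-valued continuous $f$ on $E$. $BUC(E)$ is the space of bounded real-valued uniformly continuous functions on $E$ with the supremum norm; it is $P$-invariant. $BUC^\circ(E):=\{f\in BUC(E):\lim_{t\downarrow0}\|P(t)f-f\|=0\}$, a closed $P$-invariant subspace, and $P^\circ$ is the restriction of $P$ to it. $\mathcal{L}(X)$ carries the uniform operator norm. *)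

(* Defs.v *)
From HB Require Import structures.
From mathcomp Require Import all_boot all_order all_algebra.
From mathcomp Require Import all_classical all_reals all_analysis.
From mathcomp Require Import ring lra.

Set Implicit Arguments.
Unset Strict Implicit.
Unset Printing Implicit Defensive.

Import Order.TTheory GRing.Theory Num.Theory.
Import numFieldNormedType.Exports.

Local Open Scope classical_set_scope.
Local Open Scope ring_scope.

(* [ip] turns the Banach space [H] into a real Hilbert space. *)
Definition is_hilbert (R : realType) (H : completeNormedModType R)
    (ip : {dot H for (@idfun R)}) : Prop :=
  forall h : H, ip h h = `|h| ^+ 2.

Lemma ipC (R : realType) (H : lmodType R)
    (ip : {dot H for (@idfun R)}) (u v : H) : ip u v = ip v u.
Proof. by rewrite hermC/= expr0 mul1r. Qed.

Lemma riesz_representation (R : realType) (H : completeNormedModType R)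
    (ip : {dot H for (@idfun R)}) (phi : {linear H -> R^o}) :
  is_hilbert ip -> continuous phi ->
  exists h : H, forall u : H, ip h u = phi u.
Proof.
move=> hip cphi.
pose J (u : H) : R := `|u| ^+ 2 - 2 * phi u.
have ipDD u v : ip (u + v) (u + v) = ip u u + 2 * ip u v + ip v v.
  by rewrite linearDl/= !linearDr/= (ipC ip v u); ring.
have ipZr (a : R) u v : ip u (a *: v) = a * ip u v by rewrite linearZr_LR.
have ipZl (a : R) u v : ip (a *: u) v = a * ip u v by rewrite linearZl_LR.
have phiZ (a : R) u : phi (a *: u) = a * phi u by rewrite linearZ.
have phiD u v : phi (u + v) = phi u + phi v by rewrite linearD.
have ipNr u v : ip u (- v) = - ip u v by rewrite -scaleN1r ipZr mulN1r.
have ipNl u v : ip (- u) v = - ip u v by rewrite -scaleN1r ipZl mulN1r.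
have par u v : J u + J v - 2 * J (2^-1 *: (u + v)) = `|u - v| ^+ 2 / 2.
  rewrite /J -!hip phiZ phiD ipZr ipZl !ipDD ipNr ipNl ipNr; lra.
have [M M0 hM] : exists2 M : R, 0 < M & forall u, `|phi u| <= M * `|u|.
  have /linear_bounded_continuous/linear_boundedP/pinfty_ex_gt0[M M0 hM] :=
    cphi.
  by exists M.
have lbJ u : - M ^+ 2 <= J u.
  have := hM u; rewrite ler_norml => /andP[_ h].
  have := sqr_ge0 (`|u| - M); rewrite /J; nra.
pose m := inf (range J).
have Jinf : has_inf (range J).
  split; first by exists (J 0), 0.
  by exists (- M ^+ 2) => _ [u _ <-].
have mJ u : m <= J u by apply: ge_inf; [exact: Jinf.2|exists u].
have /choice[w hw] : forall n : nat, exists u, J u < m + n.+1%:R^-1.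
  move=> n; have n0 : (0 : R) < n.+1%:R^-1 by rewrite invr_gt0.
  by have [_ [u _ <-] ?] := inf_adherent n0 Jinf; exists u.
have wc : cvgn w.
  apply/cauchy_cvgP/cauchyP => e e0.
  have e4 : 0 < e ^+ 2 / 4 by rewrite divr_gt0// exprn_gt0.
  near \oo => N.
  exists (w N); change (\forall n \near \oo, ball (w N) e (w n)); near=> n.
  rewrite -ball_normE/= -ltr_sqr ?nnegrE ?normr_ge0// ?ltW//.
  have hN := hw N; have hn := hw n; have hp := par (w N) (w n).
  have hm := mJ (2^-1 *: (w N + w n)).
  have hN2 : N.+1%:R^-1 < e ^+ 2 / 4.
    near: N; exact: (near_infty_natSinv_lt (PosNum e4)).
  have hn2 : n.+1%:R^-1 <= (N.+1%:R^-1 : R).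
    rewrite lef_pV2 ?posrE// ler_nat ltnS; near: n; exact: nbhs_infty_ge.
  move: hN hn hp hm hN2 hn2.
  move: (J _) (J _) (J _) (_^-1) (_^-1) (`|_| ^+ 2) (e ^+ 2).
  move=> a b c x y p q; lra.
set h := limn w in wc *.
have Jc : J (w n) @[n --> \oo] --> J h.
  rewrite /J; apply: cvgB.
    by rewrite expr2; apply: cvgM; exact: cvg_norm.
  apply: cvgM; first exact: cvg_cst.
  exact: (cvg_comp _ _ wc (cphi h)).
have Jm : J h <= m.
  have : m + n.+1%:R^-1 @[n --> \oo] --> (m + 0 : R).
    by apply: cvgD; [exact: cvg_cst|exact: cvg_harmonic].
  rewrite addr0 => hc.
  apply: (ler_cvg_to Jc hc); near=> n; exact/ltW.
exists h => u.
have key (t : R) : 0 <= t ^+ 2 * ip u u + 2 * t * (ip h u - phi u).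
  have := le_trans Jm (mJ (h + t *: u)).
  rewrite /J -!hip ipDD ipZr ipZl ipZr phiD phiZ; lra.
have [->|u0] := eqVneq u 0.
  by rewrite -(scale0r (0 : H)) ipZr phiZ !mul0r.
have := key (- (ip h u - phi u) / ip u u).
have uu : 0 < ip u u by rewrite hip exprn_gt0 ?normr_gt0.
set d := ip h u - phi u.
rewrite (_ : _ + _ = - (d ^+ 2 / ip u u)); last by field; rewrite gt_eqF.
rewrite oppr_ge0 pmulr_lle0 ?invr_gt0// => d2.
have : d == 0 by rewrite -sqrf_eq0 eq_le d2 sqr_ge0.
by rewrite subr_eq0 => /eqP.
Unshelve. all: by end_near. 
Qed.

(* [hadjoint ip B x] is [B^* x], where [H] is identified with its dual: the
   Riesz representative of the functional [x \o B].  See [hadjointE]. *)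
Definition hadjoint (R : realType) (E H : completeNormedModType R)
    (ip : {dot H for (@idfun R)}) (B : H -> E) (x : E -> R) : H :=
  xget 0 [set h : H | forall u : H, ip h u = x (B u)].

Lemma hadjointE (R : realType) (E H : completeNormedModType R)
    (ip : {dot H for (@idfun R)}) (B : {linear H -> E})
    (x : {linear E -> R^o}) :
  is_hilbert ip -> continuous B -> continuous x ->
  forall u : H, ip (hadjoint ip B x) u = x (B u).
Proof.
move=> hip cB cx; rewrite /hadjoint; case: xgetP => [h _ //|noh].
have [|h hh] := @riesz_representation _ _ ip (x \o B) hip.
  by move=> u; apply: continuous_comp; [exact: cB|exact: cx].
by case: (noh h).
Qed.

Definition C0_semigroup (R : realType) (E : completeNormedModType R)
    (S : R -> {linear E -> E}) : Prop :=
  [/\ forall t : R, 0 <= t -> continuous (S t),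
      forall x : E, S 0 x = x,
      forall (t s : R) (x : E), 0 <= t -> 0 <= s -> S (t + s) x = S t (S s x)
    & forall x : E, S h x @[h --> 0^'+] --> x].

(* The graph of the generator. *)
Definition generator (R : realType) (E : completeNormedModType R)
    (S : R -> {linear E -> E}) : set (E * E) :=
  [set p : E * E | h^-1 *: (S h p.1 - p.1) @[h --> 0^'+] --> p.2].

(* [ou_covariance ip S B t x y] is < Q_t x, y > for x, y in E^*; here
   [x \o S s] is S^*(s) x. *)
Definition ou_covariance (R : realType) (E H : completeNormedModType R)
    (ip : {dot H for (@idfun R)}) (S : R -> {linear E -> E})
    (B : {linear H -> E}) (t : R) (x y : {linear E -> R^o}) : R :=
  \int[lebesgue_measure]_(s in `[0, t])
    y (S s (B (hadjoint ip B (x \o S s)))).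

Notation borel E := (g_sigma_algebraType (@open E)).

Definition is_radon (R : realType) (E : completeNormedModType R)
    (mu : probability (borel E) R) : Prop :=
  forall A : set (borel E), measurable A ->
    mu A = ereal_sup [set mu K | K in [set K : set E | compact K /\ K `<=` A]].

(* The centred Gaussian law on R with variance [v]; [normal_prob] takes the
   standard deviation and is not the Dirac measure when the latter is 0. *)
Definition centred_gaussian_law (R : realType) (v : R) (A : set R) : \bar R :=
  if v == 0 then \d_(0 : R) A else normal_prob 0 (Num.sqrt v) A.

(* Every x in E^* has under [mu] a centred Gaussian law of variance [q x x]. *)
Definition is_centred_gaussian (R : realType) (E : completeNormedModType R)
    (mu : probability (borel E) R)
    (q : {linear E -> R^o} -> {linear E -> R^o} -> R) : Prop :=
  forall x : {linear E -> R^o}, continuous x ->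
    forall A : set R, measurable A ->
      mu (x @^-1` A) = centred_gaussian_law (q x x) A.

Definition ou_semigroup (R : realType) (E : completeNormedModType R)
    (S : R -> {linear E -> E}) (mu : R -> probability (borel E) R)
    (t : R) (f : E -> R) (x : E) : R :=
  \int[mu t]_y f (S t x + y).

Definition supnorm (R : realType) (E : completeNormedModType R) (f : E -> R) :
    \bar R :=
  ereal_sup [set `|f x|%:E | x in [set: E]].

Definition BUC (R : realType) (E : completeNormedModType R) : set (E -> R) :=
  [set f | bounded_fun f /\ unif_continuous f].

Definition BUC_circ (R : realType) (E : completeNormedModType R)
    (P : R -> (E -> R) -> E -> R) : set (E -> R) :=
  [set f | BUC f /\ supnorm (P t f \- f) @[t --> 0^'+] --> 0%E].

(* The operator norm, for the sup norm, of the restriction of [T] to the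
   subspace [X] of the bounded functions (+oo if it is unbounded). *)
Definition opnorm_on (R : realType) (E : completeNormedModType R)
    (X : set (E -> R)) (T : (E -> R) -> E -> R) : \bar R :=
  ereal_sup [set supnorm (T f) | f in [set f | X f /\ (supnorm f <= 1)%E]].

(* Main.v *)
(** Choose [x0] with [S t x0 != S s x0] and, by Hahn-Banach, a norm-one
   functional [x] separating these two points.  A function of [x] alone is not
   in [BUC_circ], but its time average
     [f_c y = d^-1 * \int_0^d clamp (x (S r y) - c) dr]
   is, for every real [c]: shifting the window of integration by [h] costs at
   most [2 h / d], and the noise contributes at most the average over [r] of
   [\int min (2, |x (S r y)|) dmu_h(y)], where [x \o S r] is under [mu h] a
   real Gaussian variable of variance at most a constant times [h].  Thus only
   one-dimensional marginals of [mu h] matter, and not its convergence to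
   [delta_0].  Now let [c = n (x (S t x0) + x (S s x0)) / 2]: for small [d] and
   each [y], [f_c] is [1] at [n *: S t x0 + y] and [-1] at [n *: S s x0 + y] as
   soon as [n] is large, so that by dominated convergence [P(t) f_c (n *: x0)]
   tends to [1] and [P(s) f_c (n *: x0)] to [-1]. *)
Require Import Defs.
From HB Require Import structures.
From mathcomp Require Import all_boot all_order all_algebra.
From mathcomp Require Import all_classical all_reals all_analysis.
From mathcomp Require Import measurable_realfun.
From mathcomp Require Import ring lra.

Set Implicit Arguments.
Unset Strict Implicit.
Unset Printing Implicit Defensive.

Import Order.TTheory GRing.Theory Num.Theory.
Import numFieldNormedType.Exports.

Local Open Scope classical_set_scope.
Local Open Scope ring_scope.

(** * Hahn-Banach: norming functionals *)

(** Zorn's lemma is applied to graphs that are closed under linear combinations and dominated by the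
    norm. Domination already makes such a graph single-valued: a pair [(0, e)] forces [e <= 0], and
    the difference of two values at one point can be taken in either order. A maximal graph is total
    by one-dimensional extension. *)
Lemma norming_functional (R : realType) (E : normedModType R) (v : E) :
  exists x : {linear E -> R^o}, x v = `|v| /\ forall u, `|x u| <= `|u|.
Proof.
pose lin (G : set (E * R)) := forall (a : R) u c w d,
  G (u, c) -> G (w, d) -> G (a *: u + w, a * c + d).
(* The last clause is conditional so that the empty graph, which is the union of the empty chain, is
   admissible. A maximal graph is nonempty all the same, because the graph over the multiples of [v]
   is admissible. *)
pose P := [set G : set (E * R) | [/\ lin G,
  forall u c, G (u, c) -> c <= `|u| & G !=set0 -> G (v, `|v|)]].
have [|G [[linG domG vG] maxG]] := @Zorn_bigcup _ P.
  move=> F FP totF; split.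
  - move=> a u c w d [X FX Xu] [Y FY Yw].
    have [XY|YX] := totF _ _ FX FY.
      by have [lY _ _] := FP _ FY; exists Y => //; apply: lY => //; exact: XY.
    by have [lX _ _] := FP _ FX; exists X => //; apply: lX => //; exact: YX.
  - by move=> u c [X FX]; case: (FP _ FX) => _ + _; apply.
  - move=> [p [X FX Xp]]; exists X => //.
    by case: (FP _ FX) => _ _; apply; exists p.
have {}vG : G (v, `|v|).
  apply: vG; apply: contrapT => /set0P/negP; rewrite negbK => /eqP G0.
  pose L := [set p : E * R | exists a : R, p = (a *: v, a * `|v|)].
  apply: (maxG L).
    rewrite G0; split; first exact: sub0set.
    by move=> /(_ (0 *: v, 0 * `|v|)); apply; exists 0.
  split.
  - move=> a u c w d [b [-> ->]] [b' [-> ->]]; exists (a * b + b').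
    by rewrite scalerDl scalerA mulrDl mulrA.
  - by move=> u c [a [-> ->]]; rewrite normrZ ler_wpM2r// ler_norm.
  - by move=> _; exists 1; rewrite scale1r mul1r.
have G0 : G (0, 0).
  by have := linG (-1) _ _ _ _ vG vG; rewrite scaleN1r mulN1r !addNr.
have GZ a u c : G (u, c) -> G (a *: u, a * c).
  by move=> Gu; have := linG a _ _ _ _ Gu G0; rewrite !addr0.
have GD u c w d : G (u, c) -> G (w, d) -> G (u + w, c + d).
  by move=> Gu Gw; have := linG 1 _ _ _ _ Gu Gw; rewrite scale1r mul1r.
have Gfun u c d : G (u, c) -> G (u, d) -> c = d.
  have le0 e : G (0, e) -> e <= 0 by move=> /domG; rewrite normr0.
  move=> Gc Gd; have h1 := linG (-1) _ _ _ _ Gc Gd.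
  have h2 := linG (-1) _ _ _ _ Gd Gc.
  rewrite scaleN1r addNr in h1 h2; move: (le0 _ h1) (le0 _ h2); lra.
have Gtot z : exists c, G (z, c).
  apply: contrapT => nz.
  pose X := [set e : R | exists u c, G (u, c) /\ e = c - `|u - z|].
  have Xub w d : G (w, d) -> ubound X (`|w + z| - d).
    move=> Gw _ [u [c [Gu ->]]]; have := domG _ _ (GD _ _ _ _ Gu Gw).
    have := ler_normD (u - z) (w + z); rewrite addrACA addNr addr0; lra.
  have X0 : X !=set0 by exists (0 - `|0 - z|), 0, 0.
  (* The value of the extension at [z] must lie above every [c - |u - z|] and below every
     [|w + z| - d]. The supremum of the former qualifies, since by [Xub] each of the latter is an
     upper bound. Rescaling by [|a|] then gives domination at [u + a *: z] for either sign of
     [a]. *)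
  pose al := sup X.
  have al1 u c : G (u, c) -> c - `|u - z| <= al.
    move=> Gu; apply: ub_le_sup; first by exists (`|0 + z| - 0); exact: Xub.
    by exists u, c.
  have al2 u c : G (u, c) -> al <= `|u + z| - c.
    by move=> Gu; apply: ge_sup => //; exact: Xub.
  pose G' := [set p : E * R | exists u c a,
    G (u, c) /\ p = (u + a *: z, c + a * al)].
  apply: (maxG G').
    split.
      by move=> [u c] Gu; exists u, c, 0; rewrite scale0r mul0r !addr0.
    move=> /(_ (z, al)) Gz; apply: nz; exists al; apply: Gz.
    by exists 0, 0, 1; rewrite scale1r mul1r !add0r.
  split.
  - move=> a _ _ _ _ [u [c [b [Gu [-> ->]]]]] [w [d [b' [Gw [-> ->]]]]].
    exists (a *: u + w), (a * c + d), (a * b + b'); split; first exact: linG.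
    by congr pair; [rewrite scalerDr scalerA addrACA -scalerDl|ring].
  - move=> _ _ [u [c [a [Gu [-> ->]]]]].
    have [a0|a0|->] := ltgtP a 0; last by rewrite scale0r mul0r !addr0 domG.
      have := al1 _ _ (GZ (- a)^-1 _ _ Gu).
      have na : 0 < - a by lra.
      have -> : u + a *: z = (- a) *: ((- a)^-1 *: u - z).
        rewrite scalerBr scalerA divff ?gt_eqF// scale1r scaleNr opprK//.
      rewrite normrZ gtr0_norm//; have := mulVKf (lt0r_neq0 na) c.
      by move: `|_ - z| (_^-1 * c) => p q <- h; nra.
    have := al2 _ _ (GZ a^-1 _ _ Gu).
    have -> : u + a *: z = a *: (a^-1 *: u + z).
      by rewrite scalerDr scalerA divff ?gt_eqF// scale1r.
    rewrite normrZ gtr0_norm//; have := mulVKf (lt0r_neq0 a0) c.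
    by move: `|_ + z| (_^-1 * c) => p q <- h; nra.
  - by move=> _; exists v, `|v|, 0; rewrite scale0r mul0r !addr0.
have [x xG] := choice Gtot.
have xlin : linear (x : E -> R^o).
  by move=> a u w; apply: Gfun (xG _) (linG _ _ _ _ _ (xG u) (xG w)).
pose xL := GRing.isLinear.Build _ _ _ _ _ xlin.
pose x' : {linear E -> R^o} := HB.pack x xL.
exists x'; split; first exact: Gfun (xG v) vG.
move=> u /=; rewrite ler_norml domG// andbT lerNl.
by have := domG _ _ (GZ (-1) _ _ (xG u)); rewrite mulN1r scaleN1r normrN.
Qed.

(** * Integral bounds and Gaussian tails *)

(* Free of the measurability hypotheses of [ge0_le_integral]: the integrand of
   [ou_covariance] is only known to lie between two constants. *)
Lemma ge0_le_integral_nonmeas d (T : measurableType d) (R : realType)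
    (mu : {measure set T -> \bar R}) (D : set T) (f g : T -> \bar R) :
  (forall x, D x -> (0 <= f x)%E) -> (forall x, D x -> (f x <= g x)%E) ->
  (\int[mu]_(x in D) f x <= \int[mu]_(x in D) g x)%E.
Proof.
move=> f0 fg.
have g0 x (Dx : D x) : (0 <= g x)%E := le_trans (f0 x Dx) (fg x Dx).
rewrite !ge0_integralE//; apply: ereal_sup_le => _ [h hf <-].
exists h => // x; apply: le_trans (hf x) _; rewrite /patch.
by case: ifPn => // /[1!inE] /fg.
Qed.

Lemma Rintegral_itv_le (R : realType) (f : R -> R) (h c : R) :
  0 <= h -> (forall s, 0 <= s <= h -> 0 <= f s <= c) ->
  \int[lebesgue_measure]_(s in `[0, h]) f s <= c * h.
Proof.
move=> h0 fc.
have D0 s : `[0, h]%classic s -> (0 <= (f s)%:E)%E.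
  by rewrite /= in_itv/= lee_fin => /fc/andP[].
have le1 : (\int[lebesgue_measure]_(s in `[0%R, h]) (f s)%:E <= (c * h)%:E)%E.
  have -> : (c * h)%:E = (\int[lebesgue_measure]_(s in `[0%R, h]) c%:E)%E.
    rewrite integral_cst//= lebesgue_measure_itv/= lte_fin -EFinD subr0.
    case: ltP => //; rewrite le_eqVlt ltNge h0 orbF => /eqP ->.
    by rewrite mulr0 mule0.
  apply: ge0_le_integral_nonmeas => // s.
  by rewrite /= in_itv/= lee_fin => /fc/andP[].
have ge1 := integral_ge0 lebesgue_measure D0.
by rewrite -lee_fin /Rintegral fineK// ge0_fin_numE// (le_lt_trans le1)// ltry.
Qed.

Lemma measurable_normr_gt (R : realType) (eta : R) :
  measurable [set u : R | eta < `|u|].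
Proof.
apply: open_measurable.
have := @open_comp R R (fun u : R => `|u|) [set x | eta < x].
by apply; [move=> u _; exact: norm_continuous|exact: open_gt].
Qed.

(** For [v > 0] the density of variance [v] is compared with that of variance [2 v]: their ratio is
    [sqrt 2 * exp (- u^2 / (4 v))], which is at most [2 * (4 v / u^2)] because [exp z >= 1 + z]. The
    second density has total mass one, so no moment has to be computed. What matters later is that
    the bound is linear in [v]. For [v = 0] the law is the Dirac mass at 0 and the event is null. *)
Lemma centred_gaussian_tail (R : realType) (v eta : R) : 0 <= v -> 0 < eta ->
  (centred_gaussian_law v [set u | (eta < `|u|)%R]
    <= (8 * v / eta ^+ 2)%:E)%E.
Proof.
move=> v0 eta0; rewrite /centred_gaussian_law.
have e2 : 0 < eta ^+ 2 by rewrite exprn_gt0.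
have [->|vn0] := eqVneq v 0.
  rewrite diracE memNset ?mulr0 ?mul0r//.
  by move=> /=; rewrite normr0 ltNge ltW.
have {vn0}v0 : 0 < v by rewrite lt_def vn0.
rewrite /normal_prob.
have pt u : eta < `|u| -> normal_pdf 0 (Num.sqrt v) u <=
    8 * v / eta ^+ 2 * normal_pdf 0 (Num.sqrt (2 * v)) u.
  move=> etau; rewrite !normal_pdfE ?gt_eqF ?sqrtr_gt0 ?mulr_gt0//.
  rewrite /normal_peak /normal_fun !subr0 !sqr_sqrtr ?mulr_ge0 ?(ltW v0)//.
  have -> : - u ^+ 2 / (v *+ 2) =
      - (u ^+ 2 / (4 * v)) + - u ^+ 2 / (2 * v *+ 2).
    by field; rewrite gt_eqF.
  have -> : (Num.sqrt (v * pi *+ 2))^-1 =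
      Num.sqrt 2 * (Num.sqrt (2 * v * pi *+ 2))^-1.
    have -> : 2 * v * pi *+ 2 = 2 * (v * pi *+ 2) by ring.
    rewrite (sqrtrM (v * pi *+ 2)) // invfM mulVKf//.
  rewrite expRD mulrACA; apply: ler_wpM2r.
    by rewrite mulr_ge0 ?expR_ge0// invr_ge0 sqrtr_ge0.
  have u2 : eta ^+ 2 <= u ^+ 2.
    rewrite -[u ^+ 2]real_normK ?num_real// ler_sqr ?nnegrE ?(ltW eta0)//.
    exact: ltW.
  have s2 : Num.sqrt 2 <= 2 :> R.
    by rewrite -[leRHS]ger0_norm// -sqrtr_sqr ler_sqrt ?exprn_ge0//; lra.
  have -> : 8 * v / eta ^+ 2 = 2 * (4 * v / eta ^+ 2) by field; rewrite gt_eqF.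
  apply: ler_pM => //.
  rewrite expRN -[leRHS]invrK lef_pV2 ?posrE ?expR_gt0
    ?invr_gt0 ?divr_gt0 ?mulr_gt0//.
  rewrite invf_div; apply: (@le_trans _ _ (u ^+ 2 / (4 * v))).
    by rewrite ler_wpM2r// invr_ge0 mulr_ge0// ltW.
  by apply: le_trans (expR_ge1Dx _); rewrite lerDr.
apply: (@le_trans _ _ (\int[lebesgue_measure]_(u in [set u : R | (eta < `|u|)%R])
   (8 * v / eta ^+ 2 * normal_pdf 0 (Num.sqrt (2 * v)) u)%:E)%E).
  apply: ge0_le_integral_nonmeas => u ru; rewrite lee_fin ?normal_pdf_ge0//.
  exact: pt.
apply: (@le_trans _ _ (\int[lebesgue_measure]_u
   (8 * v / eta ^+ 2 * normal_pdf 0 (Num.sqrt (2 * v)) u)%:E)%E).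
  apply: ge0_subset_integral => //; first exact: measurable_normr_gt.
  - apply/measurable_EFinP; apply: measurable_funM => //.
    exact: measurable_normal_pdf.
  - move=> u _; rewrite lee_fin mulr_ge0 ?normal_pdf_ge0//.
    by rewrite divr_ge0 ?mulr_ge0 ?ltW.
under eq_integral do rewrite EFinM.
rewrite ge0_integralZl//= ?integral_normal_pdf ?mule1//.
- by apply/measurable_EFinP; exact: measurable_normal_pdf.
- by move=> u _; rewrite lee_fin normal_pdf_ge0.
- by rewrite lee_fin divr_ge0 ?mulr_ge0 ?ltW.
Qed.

(** * Joint measurability of Carathéodory functions *)

(** Rounding [r] down to the grid of mesh [1 / (n + 1)] gives functions [G n] that depend on [r]
    only through countably many values, hence are jointly measurable; by continuity in [r] they
    converge pointwise to [F]. *)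
Lemma caratheodory_measurable d (T : measurableType d) (R : realType)
    (F : R -> T -> R) :
  (forall r, measurable_fun [set: T] (F r)) ->
  (forall y, continuous (F^~ y)) ->
  measurable_fun [set: R * T] (fun p => F p.1 p.2).
Proof.
move=> mF cF.
pose G n (p : R * T) := F ((Num.floor (p.1 * n.+1%:R))%:~R / n.+1%:R) p.2.
apply: (@measurable_fun_cvg _ _ _ _ G).
  move=> n _ A mA; rewrite setTI.
  (* The countable union over the integers [k] is indexed by naturals through [pickle]. An index
     that codes no integer is read as [k = 0], which only repeats a set of the union. *)
  have -> : G n @^-1` A = \bigcup_m
      let k : int := odflt 0 (unpickle m) in
      ([set r : R | Num.floor (r * n.+1%:R) = k] `*`
       (F (k%:~R / n.+1%:R) @^-1` A)).
    apply/seteqP; split => [[r y] /= Ay|[r y] [k _ [/= rk Ay]]].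
      by exists (pickle (Num.floor (r * n.+1%:R))) => //=; rewrite pickleK.
    by rewrite /G /= rk.
  apply: bigcupT_measurable => m /=; move: (odflt _ _) => k.
  apply: measurableX; last first.
    by rewrite -[X in measurable X]setTI; exact: mF.
  have -> : [set r : R | Num.floor (r * n.+1%:R) = k] =
      `[k%:~R / n.+1%:R, (k + 1)%:~R / n.+1%:R[%classic.
    apply/seteqP; split => r /=; rewrite in_itv/= ler_pdivrMr// ltr_pdivlMr//.
      by move=> <-; rewrite floor_le floorD1_gt.
    by move=> /floor_def.
  exact: measurable_itv.
move=> [r y] _ /=.
suff C : ((Num.floor (r * n.+1%:R))%:~R / n.+1%:R : R) @[n --> \oo] --> r.
  exact: (cvg_comp _ _ C (cF y r)).
apply/cvgrPdist_lt => e e0; near=> n.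
apply: (@le_lt_trans _ _ n.+1%:R^-1); last first.
  near: n; exact: (near_infty_natSinv_lt (PosNum e0)).
have -> : r - (Num.floor (r * n.+1%:R))%:~R / n.+1%:R =
  (r * n.+1%:R - (Num.floor (r * n.+1%:R))%:~R) / n.+1%:R.
  by rewrite mulrBl mulfK.
rewrite normrM [X in _ * X]gtr0_norm ?invr_gt0// ler_piMl// ger0_norm.
  by rewrite lerBlDl -[leRHS]intrD1 ltW// floorD1_gt.
by rewrite subr_ge0 floor_le.
Unshelve. all: by end_near. Qed.

(** * Truncation of real numbers *)

Lemma maxr_dist (R : realType) (a x y : R) :
  `|Num.max a x - Num.max a y| <= `|x - y|.
Proof.
rewrite ler_norml; have := ler_norm (x - y); have := ler_norm (y - x).
by rewrite distrC; case: (leP a x) => ?; case: (leP a y) => ? ? ?; lra.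
Qed.

Lemma minr_dist (R : realType) (a x y : R) :
  `|Num.min a x - Num.min a y| <= `|x - y|.
Proof.
rewrite ler_norml; have := ler_norm (x - y); have := ler_norm (y - x).
by rewrite distrC; case: (leP a x) => ?; case: (leP a y) => ? ? ?; lra.
Qed.

Definition unit_clamp (R : realType) (u : R) : R := Num.max (-1) (Num.min 1 u).

Lemma normr_unit_clamp (R : realType) (u : R) : `|unit_clamp u| <= 1.
Proof.
by rewrite ler_norml /unit_clamp le_max lexx/= ge_max ge_min lexx/= andbT; lra.
Qed.

Lemma unit_clamp_ge1 (R : realType) (u : R) : 1 <= u -> unit_clamp u = 1.
Proof. by move=> u1; rewrite /unit_clamp min_l// max_r//; lra. Qed.

Lemma unit_clamp_leN1 (R : realType) (u : R) : u <= -1 -> unit_clamp u = -1.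
Proof. by move=> u1; rewrite /unit_clamp max_l// ge_min u1 orbT. Qed.

Lemma unit_clamp_dist (R : realType) (u v : R) :
  `|unit_clamp u - unit_clamp v| <= Num.min 2 `|u - v|.
Proof.
rewrite le_min; apply/andP; split.
  apply: (le_trans (ler_normB _ _)).
  by have := normr_unit_clamp u; have := normr_unit_clamp v; lra.
exact: le_trans (maxr_dist _ _ _) (minr_dist _ _ _).
Qed.

Lemma continuous_unit_clamp (R : realType) : continuous (@unit_clamp R).
Proof.
move=> u; apply/cvgrPdist_lt => e e0; near=> v.
apply: le_lt_trans (unit_clamp_dist _ _) _; rewrite gt_min; apply/orP; right.
by near: v; exact: cvgr_dist_lt.
Unshelve. all: by end_near. Qed.

(** * Semigroups near time zero *)

Lemma cvg_at_right0_dist (R : realType) (V : normedModType R) (f : R -> V)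
    (l : V) (e : R) : f h @[h --> 0^'+] --> l -> 0 < e ->
  exists2 d : R, 0 < d & forall h, 0 < h < d -> `|l - f h| < e.
Proof.
move=> /cvgrPdist_lt fl /fl /nbhs_ballP[d /= d0 hd].
exists d => // h /andP[h0 hdlt].
by apply: hd => //=; rewrite /ball/= sub0r normrN gtr0_norm.
Qed.

(** Uniform boundedness. If the claim fails, there are times [(p n).1 <= 1 / (n + 1)] at which the
    operator exceeds the bound [n + 1]. These times tend to 0, so strong continuity at 0 bounds each
    orbit along them, and Banach-Steinhaus bounds the operators uniformly, a contradiction. *)
Lemma C0_semigroup_near0_le (R : realType) (E : completeNormedModType R)
    (S : R -> {linear E -> E}) : C0_semigroup S ->
  exists d M : R, [/\ 0 < d, 0 < M &
    forall r y, 0 <= r <= d -> `|S r y| <= M * `|y|].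
Proof.
move=> [cS S0 _ Scvg]; apply: contrapT => nbnd.
have /choice[p hp] : forall n : nat, exists p : R * E,
    0 <= p.1 <= n.+1%:R^-1 /\ n.+1%:R * `|p.2| < `|S p.1 p.2|.
  move=> n; apply: contrapT => np; apply: nbnd; exists n.+1%:R^-1, n.+1%:R.
  split => // r y rn; rewrite leNgt; apply/negP => ry.
  by apply: np; exists (r, y).
pose F := [set (S (p n).1 : E -> E) | n in [set: nat]].
have r0 n : 0 <= (p n).1 by have [/andP[]] := hp n.
have [||K hK] := @Banach_Steinhauss _ _ _ F _ _ 1.
- move=> _ [n _ <-]; split; last exact: linearP.
  have /linear_bounded_continuous/linear_boundedP/pinfty_ex_gt0[M M0 hM] :=
    cS _ (r0 n).
  move=> r; exists (M * r) => x xr.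
  by rewrite (le_trans (hM x))// ler_wpM2l// ltW.
- move=> x.
  have [e e0 he] := cvg_at_right0_dist (Scvg x) ltr01.
  have [N hN] : exists N : nat, N.+1%:R^-1 < e.
    by exists (Num.truncn e^-1); rewrite invf_plt ?posrE// truncnS_gt.
  (* The sum covers the finitely many [n < N]; for the other [n] the orbit is within 1 of [x]. *)
  exists (`|x| + 1 + \sum_(i < N) `|S (p i).1 x|) => _ [n _ <-].
  have [nN|Nn] := ltnP n N.
    rewrite (bigD1 (Ordinal nN))//= addrCA lerDl addr_ge0 ?addr_ge0//.
    exact: sumr_ge0.
  apply: (@le_trans _ _ (`|x| + 1)); last by rewrite lerDl sumr_ge0.
  have [->|pn0] := eqVneq (p n).1 0; first by rewrite S0 lerDl.
  have /ltW : `|x - S (p n).1 x| < 1.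
    apply: he; rewrite lt_def pn0 r0/=; have [/andP[_ /le_lt_trans]+ _] := hp n.
    by apply; apply: le_lt_trans hN; rewrite lef_pV2 ?posrE// ler_nat.
  by have := ler_distD x (S (p n).1 x) 0; rewrite !subr0 distrC; lra.
(* With this choice [K < n + 1], so the pair [p n] violates the uniform bound [K]. *)
pose n := Num.truncn K.
have [_] := hp n; set r := (p n).1; set y := (p n).2 => rny.
have y0 : 0 < `|y|.
  rewrite normr_gt0; apply: contraTneq rny => ->.
  by rewrite linear0 normr0 mulr0 ltxx.
have := hK _ (ex_intro2 _ _ n I erefl) (`|y|^-1 *: y).
rewrite linearZ !normrZ normfV normr_id mulVf ?gt_eqF// lexx => /(_ isT).
rewrite ler_pdivrMl// leNgt => /negP; apply; apply: le_lt_trans rny.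
by rewrite mulrC ler_wpM2r// ltW// truncnS_gt.
Qed.

(** For [a <= b] in the interval, [S b y - S a y = S a (S (b - a) y - y)], so right continuity at 0
    and the bound [M] give continuity on both sides. Clamping the time to [[0, d]] makes the orbit
    continuous on the whole line, the form of continuity used for the time averages below. *)
Lemma C0_orbit_continuous (R : realType) (E : completeNormedModType R)
    (S : R -> {linear E -> E}) (d M : R) : C0_semigroup S -> 0 <= d -> 0 < M ->
  (forall r y, 0 <= r <= d -> `|S r y| <= M * `|y|) ->
  forall y, continuous (fun r => S (Num.max 0 (Num.min d r)) y).
Proof.
move=> [_ S0 SD Scvg] d0 M0 SM y r.
pose cl (r : R) := Num.max 0 (Num.min d r).
have cl0 u : 0 <= cl u <= d.
  by rewrite /cl le_max lexx/= ge_max d0 ge_min lexx.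
have cl_dist u w : `|cl u - cl w| <= `|u - w|.
  exact: le_trans (maxr_dist _ _ _) (minr_dist _ _ _).
apply/cvgrPdist_lt => e e0.
have [//|f f0 hf] := cvg_at_right0_dist (Scvg y) (_ : 0 < e / M).
  by rewrite divr_gt0.
have key a b : 0 <= a -> a <= b -> b <= d -> b - a < f -> `|S b y - S a y| < e.
  move=> a0 ab bd baf; have [->|anb] := eqVneq a b.
    by rewrite subrr normr0.
  have {}ab : a < b by rewrite lt_def eq_sym anb.
  have -> : S b y = S a (S (b - a) y).
    by rewrite -SD ?subr_ge0// ?subrKC// ltW.
  rewrite -linearB.
  apply: (le_lt_trans (SM _ _ _)); first by rewrite a0/=; lra.
  by rewrite -ltr_pdivlMl// mulrC distrC hf// subr_gt0 ab.
near=> u.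
have ru : `|r - u| < f by near: u; exact: cvgr_dist_lt.
have /andP[? ?] := cl0 r; have /andP[? ?] := cl0 u.
have := cl_dist r u; rewrite -/(cl r) -/(cl u).
have [ab|/ltW ab] := leP (cl r) (cl u) => h.
  rewrite distrC; apply: key => //; rewrite distrC ger0_norm ?subr_ge0// in h.
  exact: le_lt_trans ru.
by apply: key => //; rewrite ger0_norm ?subr_ge0// in h; exact: le_lt_trans ru.
Unshelve. all: by end_near. Qed.

(** * Averages over a time interval *)

Definition itv_mean (R : realType) (d : R) (g : R -> R) : R :=
  d^-1 * \int[lebesgue_measure]_(r in `[0, d]) g r.

Lemma integrable_itv_continuous (R : realType) (g : R -> R) (a b : R) :
  continuous g -> lebesgue_measure.-integrable `[a, b] (EFin \o g).
Proof.
move=> cg; apply: continuous_compact_integrable; first exact: segment_compact.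
exact: continuous_subspaceT.
Qed.

Lemma Rintegral_itv_cst (R : realType) (a b k : R) : a <= b ->
  \int[lebesgue_measure]_(r in `[a, b]) k = k * (b - a).
Proof.
move=> ab; rewrite Rintegral_cst//= lebesgue_measure_itv/= lte_fin.
by case: ltP => //= ba; rewrite (le_anti (introT andP (conj ab ba))) subrr.
Qed.

Lemma normr_Rintegral_itv_le (R : realType) (g : R -> R) (a b k : R) :
  continuous g -> a <= b -> (forall r, a <= r <= b -> `|g r| <= k) ->
  `|\int[lebesgue_measure]_(r in `[a, b]) g r| <= k * (b - a).
Proof.
move=> cg ab gk; rewrite -Rintegral_itv_cst//.
apply: (le_trans (le_normr_Rintegral _ _)) => //.
  exact: integrable_itv_continuous.
apply: le_Rintegral => //.
- apply: integrable_norm; exact: integrable_itv_continuous.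
- exact: integrable_itv_continuous (@cst_continuous _ _ _).
Qed.

Section itv_mean.
Variables (R : realType) (d : R).
Hypothesis d0 : 0 < d.
Implicit Type g : R -> R.

Lemma normr_itv_mean_le g k : continuous g ->
  (forall r, 0 <= r <= d -> `|g r| <= k) -> `|itv_mean d g| <= k.
Proof.
move=> cg gk; rewrite /itv_mean normrM gtr0_norm ?invr_gt0//.
rewrite ler_pdivrMl// [leRHS]mulrC -[X in _ * X]subr0.
by apply: normr_Rintegral_itv_le => //; exact: ltW.
Qed.

Lemma itv_meanB g1 g2 : continuous g1 -> continuous g2 ->
  itv_mean d (fun r => g1 r - g2 r) = itv_mean d g1 - itv_mean d g2.
Proof.
move=> cg1 cg2; rewrite /itv_mean RintegralB ?mulrBr//;
  exact: integrable_itv_continuous.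
Qed.

Lemma normr_itv_mean g : continuous g ->
  `|itv_mean d g| <= itv_mean d (fun r => `|g r|).
Proof.
move=> cg; rewrite /itv_mean normrM gtr0_norm ?invr_gt0//.
rewrite ler_wpM2l ?invr_ge0 ?(ltW d0)//; apply: le_normr_Rintegral => //.
exact: integrable_itv_continuous.
Qed.

Lemma le_itv_mean g1 g2 : continuous g1 -> continuous g2 ->
  (forall r, 0 <= r <= d -> g1 r <= g2 r) -> itv_mean d g1 <= itv_mean d g2.
Proof.
move=> cg1 cg2 g12; rewrite ler_wpM2l ?invr_ge0 ?(ltW d0)//.
by apply: le_Rintegral => //;
  exact: integrable_itv_continuous.
Qed.

Lemma itv_mean_cst g k : (forall r, 0 <= r <= d -> g r = k) -> itv_mean d g = k.
Proof.
move=> gk; rewrite /itv_mean (@eq_Rintegral _ _ _ _ _ (fun=> k)); last first.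
  by move=> r; rewrite inE/= in_itv/=; exact: gk.
by rewrite Rintegral_itv_cst ?ltW// subr0 mulrCA mulVf ?mulr1 ?gt_eqF.
Qed.

(** The windows [[0, d]] and [[h, d + h]] are both completed to [[0, d + h]], so the difference of
    the integrals is that over [[d, d + h]] minus that over [[0, h]], each at most [h] in absolute
    value. This treats [h <= d] and [d < h] alike. *)
Lemma itv_mean_shift g h : continuous g -> (forall r, `|g r| <= 1) -> 0 <= h ->
  `|itv_mean d (fun r => g (r + h)) - itv_mean d g| <= 2 * h / d.
Proof.
move=> cg g1 h0.
have alg (a b c e : R) : a + b = c + e -> b - c = e - a by lra.
have shiftE : \int[lebesgue_measure]_(r in `[0, d]) g (r + h) =
    \int[lebesgue_measure]_(r in `[h, d + h]) g r.
  have D : (fun r : R => r + h)^`()%classic = cst 1.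
    apply/funext => r; rewrite derive1E deriveD//.
    by rewrite derive_id derive_cst addr0.
  have := @integration_by_substitution_increasing R (fun r => r + h) g 0 d.
  rewrite add0r /Rintegral D => ->.
  - by congr fine; apply: eq_integral => r _; rewrite !fctE/= mulr1.
  - exact: ltW.
  - by move=> x y _ _ xy; rewrite ltrD2r.
  - by move=> ? ?; exact: cvg_cst.
  - exact: is_cvg_cst.
  - exact: is_cvg_cst.
  - split => /=.
    + by move=> x _; exact: derivableD.
    + by apply: cvg_at_right_filter; apply: cvgD; [exact: cvg_id|exact: cvg_cst].
    + by apply: cvg_at_left_filter; apply: cvgD; [exact: cvg_id|exact: cvg_cst].
  - exact: continuous_subspaceT.
have ig a b := @integrable_itv_continuous R g a b cg.
have split x : 0 <= x -> x <= d + h ->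
   \int[lebesgue_measure]_(r in `[0, d + h]) g r =
   \int[lebesgue_measure]_(r in `[0, x]) g r +
   \int[lebesgue_measure]_(r in `[x, d + h]) g r.
  move=> x0 xdh.
  have := @Rintegral_itvB _ g (BLeft 0) (BRight (d + h)) x (ig _ _).
  rewrite !bnd_simp => /(_ x0 xdh); rewrite Rintegral_itv_obnd_cbnd => [<-|].
    by rewrite subrKC.
  apply: integrableS (ig x (d + h)) => //.
  by apply: subset_itvr; rewrite bnd_simp.
rewrite /itv_mean -mulrBr shiftE normrM gtr0_norm ?invr_gt0// [leRHS]mulrC.
rewrite ler_wpM2l ?invr_ge0 ?(ltW d0)//.
have dh : d <= d + h by rewrite lerDl.
have hdh : h <= d + h by rewrite lerDr ltW.
have sd := split d (ltW d0) dh; have sh := split h h0 hdh.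
rewrite sh in sd; have {sd sh split} -> :
  \int[lebesgue_measure]_(r in `[h, d + h]) g r
  - \int[lebesgue_measure]_(r in `[0, d]) g r =
  \int[lebesgue_measure]_(r in `[d, d + h]) g r
  - \int[lebesgue_measure]_(r in `[0, h]) g r.
  exact: alg sd.
apply: (le_trans (ler_normB _ _)).
have := @normr_Rintegral_itv_le _ g d (d + h) 1 cg dh (fun r _ => g1 r).
have -> : d + h - d = h by rewrite addrC addKr.
rewrite mul1r => le1.
have := @normr_Rintegral_itv_le _ g 0 h 1 cg h0 (fun r _ => g1 r).
by rewrite subr0 mul1r => le2; rewrite mulr_natl mulr2n lerD.
Qed.

End itv_mean.

(** * Expectations of bounded functions and of averages *)

Lemma continuous_borel_measurable (R : realType) (E : completeNormedModType R)
    (f : E -> R) : continuous f -> measurable_fun [set: borel E] f.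
Proof.
move=> cf mD; apply: (measurability _ (RGenOInfty.measurableE R)) => //.
move=> _ [_ [a ->] <-]; rewrite setTI; apply: sub_gen_smallest => /=.
have := @open_comp E R f `]a, +oo[%classic.
by apply; [move=> x _; exact: cf|exact: interval_open].
Qed.

Lemma bounded_integrable d (T : measurableType d) (R : realType)
    (P : probability T R) (f : T -> R) (k : R) :
  measurable_fun setT f -> (forall x, `|f x| <= k) ->
  P.-integrable setT (EFin \o f).
Proof.
move=> mf fk; apply: measurable_bounded_integrable => //.
  by rewrite [X in (X < _)%E](_ : _ = 1%E) ?ltry//; exact: probability_setT.
exists k; split; first exact: num_real.
by move=> M kM x _; exact/ltW/(le_lt_trans (fk x)).
Qed.

(** The integrand is at most [eta] where [|g| <= eta], and at most 2 on the remaining event, whose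
    probability is at most [p]. *)
Lemma integral_min2_le d (T : measurableType d) (R : realType)
    (P : probability T R) (g : T -> R) (eta p : R) :
  measurable_fun setT g -> 0 < eta ->
  (P [set y | (eta < `|g y|)%R] <= p%:E)%E ->
  (\int[P]_y (Num.min 2 `|g y|)%:E <= (eta + 2 * p)%:E)%E.
Proof.
move=> mg eta0 gp.
pose A := [set y | (eta < `|g y|)%R].
have mA : measurable A.
  rewrite -[A]setTI; exact: mg measurableT _ (measurable_normr_gt eta).
apply: (@le_trans _ _ (\int[P]_y (eta%:E + 2%:E * (\1_A y)%:E))%E).
  apply: ge0_le_integral_nonmeas => y _.
    by rewrite lee_fin le_min normr_ge0 ler0n.
  rewrite -EFinM -EFinD lee_fin indicE.
  have [yA|yA] := boolP (y \in A).
    by rewrite ge_min mulr1; apply/orP; left; lra.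
  rewrite mulr0 addr0 ge_min; apply/orP; right; rewrite leNgt.
  by apply: contra yA => yA; rewrite inE.
have mI : measurable_fun setT (fun y => (\1_A y)%:E : \bar R).
  by apply/measurable_EFinP; exact: measurable_indic.
have I0 y : setT y -> (0 <= (\1_A y)%:E :> \bar R)%E by rewrite lee_fin.
rewrite ge0_integralD//=; last 2 first.
- by move=> y _; rewrite lee_fin ltW.
- exact: measurable_funeM.
rewrite integral_cst//= ge0_integralZl//.
rewrite integral_indic//= setIT (EFinD eta) (EFinM 2 p).
rewrite [X in (_ * X + _)%E](_ : _ = 1%E); last exact: probability_setT.
by rewrite mule1 leeD2l// lee_pmul2l.
Qed.

(** By Tonelli, the expectation of the time average is the time average of the expectations. *)
Lemma integral_itv_mean_le d' (T : measurableType d') (R : realType)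
    (P : probability T R) (F : R -> T -> R) (d k : R) : 0 < d ->
  (forall r, measurable_fun setT (F r)) -> (forall y, continuous (F^~ y)) ->
  (forall r y, 0 <= F r y) ->
  (forall r, 0 <= r <= d -> (\int[P]_y (F r y)%:E <= k%:E)%E) ->
  (\int[P]_y (itv_mean d (F^~ y))%:E <= k%:E)%E.
Proof.
move=> d0 mF cF F0 Fk.
(* The window is encoded by an indicator, so that Tonelli applies on the full product; joint
   measurability comes from [caratheodory_measurable]. *)
pose f (p : R * T) : \bar R := (\1_`[0, d] p.1 * F p.1 p.2)%:E.
have f0 p : (0 <= f p)%E by rewrite lee_fin mulr_ge0.
have mf : measurable_fun setT f.
  apply/measurable_EFinP/measurable_funM; last exact: caratheodory_measurable.
  have mI : measurable_fun setT (\1_`[0, d] : R -> R) by exact: measurable_indic.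
  exact: (measurableT_comp mI measurable_fst).
have k0 : 0 <= k.
  rewrite -lee_fin; apply: le_trans (Fk 0 _); last by rewrite lexx ltW.
  by apply: integral_ge0 => y _; rewrite lee_fin.
have meanE y : (itv_mean d (F^~ y))%:E =
    ((d^-1)%:E * \int[lebesgue_measure]_r f (r, y))%E.
  rewrite /itv_mean EFinM /Rintegral fineK; last first.
    exact/integrable_fin_num/integrable_itv_continuous.
  congr (_ * _)%E; rewrite [LHS]integral_mkcond; apply: eq_integral => r _.
  rewrite /f /patch/= indicE; case: ifPn => ?; first by rewrite mul1r.
  by rewrite mul0r.
under eq_integral do rewrite meanE.
rewrite ge0_integralZl//=; last 3 first.
- exact: measurable_fun_fubini_tonelli_G.
- by move=> y _; apply: integral_ge0.
- by rewrite lee_fin invr_ge0 ltW.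
rewrite -(@fubini_tonelli _ _ _ _ _ lebesgue_measure P f mf f0).
have -> : k%:E = ((d^-1)%:E * \int[lebesgue_measure]_r (k * \1_`[0, d] r)%:E)%E.
  under eq_integral do rewrite EFinM.
  rewrite ge0_integralZl//.
    rewrite integral_indic//= setIT lebesgue_measure_itv/= lte_fin d0 -EFinD -!EFinM.
    by rewrite subr0 mulrCA mulVf ?mulr1// gt_eqF.
  by apply/measurable_EFinP; exact: measurable_indic.
rewrite lee_pmul2l//; last by rewrite lte_fin invr_gt0.
apply: ge0_le_integral_nonmeas => r _; first by apply: integral_ge0.
rewrite /f/= indicE; case: (boolP (r \in _)) => [|_].
  rewrite inE/= in_itv/= => /Fk; rewrite mulr1.
  by under [in X in _ -> X]eq_integral do rewrite mul1r.
under eq_integral do rewrite mul0r.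
by rewrite integral0 mulr0.
Qed.

(** * Variance of the noise over a short time *)

(** With [g] the vector [B^* S(s)^* x], the integrand [x (S s (B g))] equals [|g|^2]. The hypothesis
    bounds it by [K |g|], whence [|g| <= K] and the integrand lies between 0 and [K^2]. *)
Lemma ou_covariance_le (R : realType) (E H : completeNormedModType R)
    (ip : {dot H for (@idfun R)}) (S : R -> {linear E -> E})
    (B : {linear H -> E}) (x : {linear E -> R^o}) (K h : R) :
  is_hilbert ip -> C0_semigroup S -> continuous B -> continuous x -> 0 <= h ->
  (forall s u, 0 <= s <= h -> `|x (S s (B u))| <= K * `|u|) ->
  0 <= ou_covariance ip S B h x x <= K ^+ 2 * h.
Proof.
move=> hH [cS _ _ _] cB cx h0 xK.
have key s : 0 <= s <= h ->
    0 <= x (S s (B (hadjoint ip B (x \o S s)))) <= K ^+ 2.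
  move=> sh; have [/andP[s0 _] K1] := (sh, xK s).
  have cxS : continuous (x \o S s).
    by move=> u; apply: continuous_comp; [exact: cS|exact: cx].
  have := hadjointE hH cB cxS; set g := hadjoint _ _ _ => gE.
  have := K1 g sh; rewrite -[x _](gE g) hH exprn_ge0//= ger0_norm ?exprn_ge0//.
  rewrite expr2; have [-> _|g0] := eqVneq g 0.
    by rewrite normr0 mul0r sqr_ge0.
  by rewrite ler_pM2r ?normr_gt0// => gK; rewrite expr2 ler_pM.
apply/andP; split; last exact: Rintegral_itv_le.
by apply: Rintegral_ge0 => s; rewrite /= in_itv/= => /key/andP[].
Qed.

(** * The averaged test functions and their strong continuity *)

Lemma lipschitz_le_continuous (R : realType) (V : normedModType R) (f : V -> R)
    (k : R) : (forall y z, `|f y - f z| <= k * `|y - z|) -> continuous f.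
Proof.
move=> fk y; apply/cvgrPdist_lt => e e0.
have k0 : 0 < `|k| + 1 by rewrite ltr_wpDl.
near=> z.
apply: le_lt_trans (fk _ _) _.
apply: (@le_lt_trans _ _ ((`|k| + 1) * `|y - z|)).
  by rewrite ler_wpM2r// (le_trans (ler_norm _))// lerDl.
rewrite -ltr_pdivlMl// mulrC; near: z; apply: cvgr_dist_lt => //.
by rewrite divr_gt0.
Unshelve. all: by end_near. Qed.

Section clamped_mean.
Variables (R : realType) (E : completeNormedModType R).
Variables (phi : R -> {linear E -> R^o}) (d M : R).
Hypothesis d0 : 0 < d.
Hypothesis phi_cont : forall y, continuous (fun r => phi r y : R).
Hypothesis phi_le : forall r y, `|phi r y| <= M * `|y|.

(** This is the function [f_c] of the overview: [phi r] stands for [x \o S r], with the time clamped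
    so that it is defined and continuous for all real [r]. *)
Definition clamped_mean (c : R) (y : E) : R :=
  itv_mean d (fun r => unit_clamp (phi r y - c)).

Let continuous_sub (f g : R -> R) : continuous f -> continuous g ->
  continuous (fun r => f r - g r).
Proof. by move=> cf cg r; exact: cvgB (cf r) (cg r). Qed.

Let continuous_norm (f : R -> R) : continuous f -> continuous (fun r => `|f r|).
Proof. by move=> cf r; exact: cvg_norm (cf r). Qed.

Let continuous_clamp c y : continuous (fun r => unit_clamp (phi r y - c)).
Proof.
have /continuous_sub cB := @phi_cont y; move=> r.
exact: (cvg_comp _ _ (cB _ (@cst_continuous _ _ c) r) (@continuous_unit_clamp _ _)).
Qed.

Lemma normr_clamped_mean c y : `|clamped_mean c y| <= 1.
Proof.
by apply: normr_itv_mean_le => // r _; exact: normr_unit_clamp.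
Qed.

Let continuous_min2 y : continuous (fun r => Num.min 2 `|phi r y| : R).
Proof.
have cn := continuous_norm (@phi_cont y).
move=> r; have H := @continuous_min R R (fun=>2) (fun r=>`|phi r y|) r.
  exact: (H (@cst_continuous _ _ _ _) (cn r)).
Qed.

(** The bound depends only on [y - z]. It serves twice: with [|phi r u| <= M |u|] it gives the
    Lipschitz estimate, and integrated against [mu h] it controls the noise. *)
Lemma clamped_mean_dist c y z : `|clamped_mean c y - clamped_mean c z| <=
  itv_mean d (fun r => Num.min 2 `|phi r (y - z)|).
Proof.
rewrite /clamped_mean -itv_meanB//; apply: le_trans (normr_itv_mean d0 _) _.
  exact: continuous_sub.
apply: le_itv_mean => //.
  exact/continuous_norm/continuous_sub.
move=> r _; apply: le_trans (unit_clamp_dist _ _) _.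
have -> // : phi r y - c - (phi r z - c) = phi r (y - z).
by rewrite [RHS]linearB/=; ring.
Qed.

Lemma clamped_mean_lip c y z :
  `|clamped_mean c y - clamped_mean c z| <= M * `|y - z|.
Proof.
apply: le_trans (clamped_mean_dist _ _ _) _.
apply: le_trans (ler_norm _) _; apply: normr_itv_mean_le => // r _.
by rewrite ger0_norm ?le_min ?ler0n ?normr_ge0// ge_min phi_le orbT.
Qed.

Lemma clamped_mean_BUC c : BUC (clamped_mean c).
Proof.
split.
  exists 1; split; first exact: num_real.
  by move=> k k1 y _; apply: le_trans (normr_clamped_mean c y) (ltW k1).
apply/unif_continuousP => e e0.
have M0 : 0 < `|M| + 1 by rewrite ltr_wpDl.
exists (e / (`|M| + 1)); first by rewrite /= divr_gt0.
move=> [y z] /=; rewrite -!ball_normE/= => yz.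
apply: le_lt_trans (clamped_mean_lip _ _ _) _.
apply: (@le_lt_trans _ _ ((`|M| + 1) * `|y - z|)).
  by rewrite ler_wpM2r// (le_trans (ler_norm _))// lerDl.
by rewrite -ltr_pdivlMl// mulrC.
Qed.

Lemma continuous_clamped_mean c : continuous (clamped_mean c).
Proof. exact: lipschitz_le_continuous (clamped_mean_lip c). Qed.

Variables (S : R -> {linear E -> E}) (mu : R -> probability (borel E) R) (C : R).
Hypothesis phi_shift : forall r h y, 0 <= r <= d -> 0 <= h <= d ->
  phi r (S h y) = phi (r + h) y.
Hypothesis phi_tail : forall r h eta, 0 <= r <= d -> 0 <= h <= d -> 0 < eta ->
  (mu h [set y | (eta < `|phi r y|)%R] <= (C * h / eta ^+ 2)%:E)%E.

Lemma clamped_mean_shift c h y : 0 <= h <= d ->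
  `|clamped_mean c (S h y) - clamped_mean c y| <= 2 * h / d.
Proof.
move=> hd; have /andP[h0 _] := hd.
have -> : clamped_mean c (S h y) =
    itv_mean d (fun r => unit_clamp (phi (r + h) y - c)).
  rewrite /clamped_mean /itv_mean; congr (_ * _).
  by apply: eq_Rintegral => r; rewrite inE/= in_itv/= => rd; rewrite phi_shift.
apply: (itv_mean_shift d0 (@continuous_clamp c y)) => // r.
exact: normr_unit_clamp.
Qed.

(** The increment of the test function from [z] to [z + w] is at most the average of
    [min (2, |phi r w|)], which does not involve [z]. Its expectation is estimated by Tonelli and
    the tail bound, so the estimate is uniform in [y]. The level [eta] stays free, to be fixed
    before [h] tends to 0. *)
Lemma ou_clamped_mean_dist c h eta y : 0 <= h <= d -> 0 < eta ->
  `|ou_semigroup S mu h (clamped_mean c) y - clamped_mean c (S h y)| <=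
  eta + 2 * (C * h / eta ^+ 2).
Proof.
move=> hd eta0; pose z := S h y; pose f := clamped_mean c.
have mf : measurable_fun [set: borel E] (fun w => f (z + w)).
  apply: continuous_borel_measurable => w.
  apply: continuous_comp; last exact: continuous_clamped_mean.
  by apply: cvgD; [exact: cvg_cst|exact: cvg_id].
have phi_cts r : continuous (phi r : E -> R).
  by apply: (@lipschitz_le_continuous _ _ _ M) => u v; rewrite -linearB.
have intf : (mu h).-integrable setT (EFin \o fun w : borel E => f (z + w)).
  apply: (@bounded_integrable _ _ _ (mu h) _ 1 mf) => w; exact: normr_clamped_mean.
have intc : (mu h).-integrable setT (EFin \o fun w : borel E => f z).
  by apply: (@bounded_integrable _ _ _ _ _ 1) => // w; exact: normr_clamped_mean.
rewrite /ou_semigroup -/z -/f; have -> : f z = \int[mu h]_w f z.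
  rewrite Rintegral_cst// [X in fine X](_ : _ = 1%E) ?mulr1//.
  exact: probability_setT.
rewrite -RintegralB//.
apply: le_trans (le_normr_Rintegral _ _) _ => //.
  have := integrableB measurableT intf intc.
  by apply: eq_integrable => // w _.
have le1 : (\int[mu h]_w (`|f (z + w) - f z|)%:E
    <= (eta + 2 * (C * h / eta ^+ 2))%:E)%E.
  apply: le_trans (_ : (\int[mu h]_w (itv_mean d
    (fun r => Num.min 2 `|phi r w|))%:E <= _)%E); last first.
    apply: (@integral_itv_mean_le _ (borel E) _ (mu h)
      (fun r w => Num.min 2 `|phi r w| : R)) => //.
    - move=> r; apply: continuous_borel_measurable => w.
      have H := @continuous_min R E (fun=> 2) (fun w => `|phi r w|) w.
      by apply: H; [exact: cst_continuous|exact: cvg_norm (@phi_cts r w)].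
    - move=> r rd; apply: integral_min2_le => //; last exact: phi_tail.
      exact: (@continuous_borel_measurable _ _ (phi r) (@phi_cts r)).
  apply: ge0_le_integral_nonmeas => w _; rewrite lee_fin//.
  by have := clamped_mean_dist c (z + w) z; rewrite addrAC subrr add0r.
have ge0 : (0 <= \int[mu h]_w (`|f (z + w) - f z|)%:E)%E.
  by apply: integral_ge0 => w _; rewrite lee_fin.
by rewrite -lee_fin /Rintegral fineK// ge0_fin_numE// (le_lt_trans le1)// ltry.
Qed.

Lemma clamped_mean_BUC_circ c : BUC_circ (ou_semigroup S mu) (clamped_mean c).
Proof.
split; first exact: clamped_mean_BUC.
have sup0 g : (0 <= supnorm (g : E -> R))%E.
  by apply: le_trans (ereal_sup_ubound _); last (by exists 0); rewrite lee_fin.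
suff near0 e : 0 < e -> \forall t \near 0^'+,
    (supnorm (ou_semigroup S mu t (clamped_mean c) \- clamped_mean c)%R <= e%:E)%E.
  apply/fine_cvgP; split.
    near=> t; rewrite ge0_fin_numE//.
    apply: (@le_lt_trans _ _ 1%:E); last exact: ltry.
    by near: t; exact: near0.
  apply/cvgrPdist_le => e e0; near=> t.
  have te : (supnorm (ou_semigroup S mu t (clamped_mean c) \- clamped_mean c)%R
    <= e%:E)%E by near: t; exact: near0.
  rewrite sub0r normrN ger0_norm ?fine_ge0//= -lee_fin fineK//.
  by rewrite ge0_fin_numE// (le_lt_trans te)// ltry.
move=> e0.
pose eta := e / 3.
have eta0 : 0 < eta by rewrite divr_gt0.
pose k := 2 / d + 2 * C / eta ^+ 2.
(* For [0 < t < m] the terms linear in [t] add up to [t * k <= eta], so the total error is at most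
   [2 e / 3]. The denominator [|k| + 1] is positive whatever the sign of [C]. *)
pose m := Num.min d (eta / (`|k| + 1)).
have m0 : 0 < m by rewrite lt_min d0 divr_gt0// ltr_wpDl.
near=> t.
have t0 : 0 < t by near: t; exact: nbhs_right_gt.
have : t < m by near: t; exact: nbhs_right_lt.
rewrite lt_min => /andP[td tk].
apply: ge_ereal_sup => _ [y _ <-]; rewrite lee_fin /=.
have tdd : 0 <= t <= d by rewrite (ltW t0) ltW.
have := ou_clamped_mean_dist c y tdd eta0; have := clamped_mean_shift c y tdd.
set a := clamped_mean c (S t y) => h1 h2.
apply: le_trans (ler_distD a _ _) _; apply: le_trans (lerD h2 h1) _.
have tk2 : t * k <= eta.
  apply: (@le_trans _ _ (t * (`|k| + 1))).
    by rewrite ler_wpM2l ?(ltW t0)// (le_trans (ler_norm _))// lerDl.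
  by rewrite -ler_pdivlMr ?(ltW tk)// ltr_wpDl.
have -> : eta + 2 * (C * t / eta ^+ 2) + 2 * t / d = eta + t * k.
  by rewrite /k; ring.
by apply: le_trans (lerD (lexx _) tk2) _; rewrite /eta; lra.
Unshelve. all: by end_near. Qed.

End clamped_mean.

(** * Limits of expectations and estimates of operator norms *)

(** Dominated convergence with dominating constant 1; the rank from which [g n y = l] may depend on
    [y]. *)
Lemma bounded_eventually_cst_cvg d (T : measurableType d) (R : realType)
    (P : probability T R) (g : nat -> T -> R) (l : R) :
  (forall n, measurable_fun setT (g n)) -> (forall n y, `|g n y| <= 1) ->
  (forall y, \forall n \near \oo, g n y = l) ->
  \int[P]_y g n y @[n --> \oo] --> l.
Proof.
move=> mg g1 gl.
have : (\int[P]_y (g n y)%:E @[n --> \oo] --> \int[P]_y l%:E)%E.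
  apply: (@dominated_cvg _ _ _ _ _ measurableT _ _ (cst 1%E)) => //.
  - by move=> n; apply/measurable_EFinP.
  - move=> y _; apply: cvg_near_cst; apply: filterS (gl y) => n -> //.
  - have := @bounded_integrable _ _ _ P (fun=> 1) 1 (@measurable_cst _ _ _ _ _ _).
    by apply => y; rewrite normr1.
  - by move=> n y _; rewrite lee_fin.
rewrite integral_cst//= [X in (_ * X)%E](_ : _ = 1%E); last exact: probability_setT.
by rewrite mule1 => /fine_cvg.
Qed.

Lemma BUC_continuous (R : realType) (E : completeNormedModType R) (f : E -> R) :
  BUC f -> continuous f.
Proof.
move=> [_ /unif_continuousP uf] y; apply/cvgrPdist_lt => e /uf[/= d d0 hd].
near=> z; have := hd (y, z); rewrite /= -!ball_normE/=; apply.
near: z; exact: cvgr_dist_lt.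
Unshelve. all: by end_near. Qed.

Lemma normr_ou_semigroup (R : realType) (E : completeNormedModType R)
    (S : R -> {linear E -> E}) (mu : R -> probability (borel E) R)
    (f : E -> R) (t : R) (x : E) :
  BUC f -> (supnorm f <= 1)%E -> `|ou_semigroup S mu t f x| <= 1.
Proof.
move=> /BUC_continuous cf f1.
have fy y : `|f y| <= 1.
  by rewrite -lee_fin (le_trans _ f1)//; apply: ereal_sup_ubound; exists y.
have mf : measurable_fun [set: borel E] (fun y => f (S t x + y)).
  apply: continuous_borel_measurable => y.
  by apply: continuous_comp; [apply: cvgD; [exact: cvg_cst|exact: cvg_id]|exact: cf].
have intf := @bounded_integrable _ _ _ (mu t) _ 1 mf (fun=> fy _).
apply: le_trans (le_normr_Rintegral measurableT intf) _.
have -> : 1 = \int[mu t]_y 1.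
  rewrite Rintegral_cst// [X in fine X](_ : _ = 1%E) ?mulr1//.
  exact: probability_setT.
apply: le_Rintegral => //; first exact: integrable_norm.
have := @bounded_integrable _ _ _ (mu t) (fun=> 1) 1 (@measurable_cst _ _ _ _ _ _).
by apply => y; rewrite normr1.
Qed.

Lemma opnorm_on_ge (R : realType) (E : completeNormedModType R)
    (X : set (E -> R)) (T : (E -> R) -> E -> R) (f : E -> R) (y : E) :
  X f -> (forall z, `|f z| <= 1) -> ((`|T f y|)%:E <= opnorm_on X T)%E.
Proof.
move=> Xf f1; apply: (@le_trans _ _ (supnorm (T f))).
  by apply: ereal_sup_ubound; exists y.
apply: ereal_sup_ubound; exists f => //; split=> //.
by apply: ge_ereal_sup => _ [z _ <-]; rewrite lee_fin.
Qed.

(** * The distance between two operators of the semigroup *)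

Theorem proposition2p4 (R : realType) (E H : completeNormedModType R)
    (ip : {dot H for (@idfun R)}) (hH : is_hilbert ip)
    (S : R -> {linear E -> E}) (hS : C0_semigroup S)
    (A : set (E * E)) (hA : A = generator S)
    (B : {linear H -> E}) (hB : continuous B)
    (mu : R -> probability (borel E) R)
    (hmu : forall t : R, 0 <= t ->
       is_radon (mu t) /\
       is_centred_gaussian (mu t) (ou_covariance ip S B t)) :
  forall t s : R, 0 <= t -> 0 <= s -> (S t : E -> E) <> (S s : E -> E) ->
    opnorm_on (BUC_circ (ou_semigroup S mu))
      (fun f => ou_semigroup S mu t f \- ou_semigroup S mu s f) = 2%:E.
Proof.
move=> t s t0 s0 /eqP nts.
apply/eqP; rewrite eq_le; apply/andP; split.
  (* Upper bound: both operators are contractions for the supremum norm, so the difference has norm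
     at most [1 + 1]. *)
  apply: ge_ereal_sup => _ [f [[Bf _] f1] <-].
  apply: ge_ereal_sup => _ [y _ <-]; rewrite lee_fin/=.
  apply: le_trans (ler_normB _ _) _; rewrite -[leRHS]/(1 + 1).
  by apply: lerD; exact: normr_ou_semigroup.
have [x0 nx0] : exists x0, S t x0 != S s x0.
  apply: contrapT => nex; move/negP: nts; apply; apply/eqP/funext => y.
  by apply: contrapT => /eqP ny; apply: nex; exists y.
have [x [xv xle]] := norming_functional (S t x0 - S s x0).
pose a := x (S t x0) : R; pose b := x (S s x0) : R.
have ab : 0 < a - b.
  by rewrite /a /b -[_ - _](linearB x) xv normr_gt0 subr_eq0.
have cx : continuous x.
  apply: (@lipschitz_le_continuous _ _ (x : E -> R) 1) => u v.
  by rewrite -linearB mul1r.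
have [d0 [M [d00 M0 SM]]] := C0_semigroup_near0_le hS.
have orb := C0_orbit_continuous hS (ltW d00) M0 SM.
have [cS S0 SD Scvg] := hS.
(* The midpoint of [a] and [b] is at distance [2 q] from each. Replacing [x] by [phi r] costs at
   most [q], which leaves a margin [q] on either side. *)
pose q := (a - b) / 4.
have q0 : 0 < q by rewrite divr_gt0.
have [d1 d10 near_t] := cvg_at_right0_dist (Scvg (S t x0)) q0.
have [d2 d20 near_s] := cvg_at_right0_dist (Scvg (S s x0)) q0.
(* The halves ensure [r + h <= d0] for [r] and [h] in [[0, d]], where the clamp [cl] is inert, and
   the strict inequalities [r < d1] and [r < d2] required by [near_t] and [near_s]. *)
pose d := Num.min (d0 / 2) (Num.min (d1 / 2) (d2 / 2)).
have d_gt0 : 0 < d by rewrite !lt_min !divr_gt0.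
have /and3P[dd0 dd1 dd2] : [&& d <= d0 / 2, d <= d1 / 2 & d <= d2 / 2].
  by rewrite /d !ge_min !lexx !orbT.
pose cl r := Num.max 0 (Num.min d0 r).
have clE r : 0 <= r -> r <= d0 -> cl r = r.
  by move=> r0 rd; rewrite /cl min_r// max_r.
pose phi r : {linear E -> R^o} := x \o S (cl r).
have phiE r y : 0 <= r -> r <= d0 -> phi r y = x (S r y).
  by move=> r0 rd; rewrite /phi /= clE.
have phi_cont y : continuous (fun r => phi r y : R).
  by move=> r; apply: (cvg_comp _ _ (orb y r)); exact: cx.
have phi_le r y : `|phi r y| <= M * `|y|.
  apply: le_trans (xle _) (SM _ _ _).
  by rewrite /cl le_max lexx ge_max (ltW d00) ge_min lexx.
have phi_shift r h y : 0 <= r <= d -> 0 <= h <= d ->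
    phi r (S h y) = phi (r + h) y.
  move=> /andP[r0 rd] /andP[h0 hd].
  by rewrite !phiE ?addr_ge0 ?SD//; lra.
have [K K0 hK] : exists2 K : R, 0 < K & forall u, `|B u| <= K * `|u|.
  have /linear_bounded_continuous/linear_boundedP/pinfty_ex_gt0[K K0 hK] := hB.
  by exists K.
(* Only the Gaussian law of the single functional [phi r] enters. The 8 comes from the tail bound,
   and [(M * K) ^+ 2] from [|phi (r + s) (B u)| <= M * K * |u|] in the covariance estimate. *)
have phi_tail r h eta : 0 <= r <= d -> 0 <= h <= d -> 0 < eta ->
    (mu h [set y | (eta < `|phi r y|)%R]
      <= (8 * (M * K) ^+ 2 * h / eta ^+ 2)%:E)%E.
  move=> rd hd eta0; have /andP[h0 hd'] := hd; have /andP[r0 rd'] := rd.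
  have cphi : continuous (phi r).
    apply: (@lipschitz_le_continuous _ _ (phi r : E -> R) M) => u v.
    by rewrite -linearB.
  have [_ /(_ (phi r) cphi)] := hmu h h0.
  move=> /(_ _ (measurable_normr_gt eta)) ->.
  have /andP[q_ge0 q_le] : 0 <= ou_covariance ip S B h (phi r) (phi r) <=
      (M * K) ^+ 2 * h.
    apply: ou_covariance_le => // u v /andP[u0 uh].
    rewrite phi_shift ?rd ?u0 ?(le_trans uh)//.
    apply: le_trans (phi_le _ _) _; rewrite -mulrA ler_wpM2l ?(ltW M0)//.
  apply: le_trans (centred_gaussian_tail q_ge0 eta0) _.
  rewrite lee_fin ler_wpM2r ?invr_ge0 ?exprn_ge0 ?(ltW eta0)//.
  by rewrite -mulrA ler_wpM2l.
pose c (n : nat) : R := n%:R * ((a + b) / 2).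
pose f n := clamped_mean phi d (c n).
have fcirc n : BUC_circ (ou_semigroup S mu) (f n).
  exact: (clamped_mean_BUC_circ d_gt0 phi_cont phi_le phi_shift phi_tail).
have f1 n y : `|f n y| <= 1 by exact: normr_clamped_mean.
have fcvg u l : 0 <= u ->
    (forall y, \forall n \near \oo, f n (S u (n%:R *: x0) + y) = l) ->
    ou_semigroup S mu u (f n) (n%:R *: x0) @[n --> \oo] --> l.
  move=> u0 fl; apply: bounded_eventually_cst_cvg => //.
  move=> n; have [/BUC_continuous cf _] := fcirc n.
  apply: continuous_borel_measurable => y.
  by apply: continuous_comp; [apply: cvgD; [exact: cvg_cst|exact: cvg_id]|exact: cf].
have phi_near u e r : 0 < e -> (forall h, 0 < h < e -> `|u - S h u| < q) ->
    d <= e / 2 -> 0 <= r <= d -> `|x u - phi r u| <= q.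
  move=> e0 ue de /andP[r0 rd]; rewrite phiE//; last by lra.
  rewrite -linearB; apply: le_trans (xle _) _.
  have [->|rn0] := eqVneq r 0; first by rewrite S0 subrr normr0 ltW.
  by apply/ltW/ue; rewrite lt_def rn0 r0/=; lra.
have phi_t r : 0 <= r <= d -> q <= phi r (S t x0) - (a + b) / 2.
  move=> /(phi_near _ _ _ d10 near_t dd1).
  by rewrite -/a ler_norml => /andP[_]; rewrite /q; lra.
have phi_s r : 0 <= r <= d -> phi r (S s x0) - (a + b) / 2 <= - q.
  move=> /(phi_near _ _ _ d20 near_s dd2).
  by rewrite -/b ler_norml => /andP[+ _]; rewrite /q; lra.
(* From this rank on, the margin [n q] exceeds [|phi r y|] by at least 1 for all [r] in the window
   at once. The clamp is then saturated throughout, and the average is exactly 1 or -1. *)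
have large y : \forall n \near \oo, 1 + M * `|y| <= n%:R * q.
  near=> n; rewrite -ler_pdivrMr//; near: n; exact: nbhs_infty_ger.
have phi_split n r u y : phi r (n%:R *: u + y) - c n =
    n%:R * (phi r u - (a + b) / 2) + phi r y.
  have -> : phi r (n%:R *: u + y) = n%:R * phi r u + phi r y :> R.
    by rewrite linearD linearZ.
  by rewrite /c; ring.
have ft : ou_semigroup S mu t (f n) (n%:R *: x0) @[n --> \oo] --> (1 : R).
  apply: fcvg => // y; near=> n; apply: itv_mean_cst => // r rd.
  apply: unit_clamp_ge1; rewrite linearZ phi_split.
  have := phi_t r rd; have : 1 + M * `|y| <= n%:R * q by near: n.
  have := phi_le r y; rewrite ler_norml => /andP[+ _].
  have : 0 <= n%:R :> R by []; move: (phi r y : R) (phi r _ - _) => p w.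
  by move=> ? ? ? ?; nra.
have fs : ou_semigroup S mu s (f n) (n%:R *: x0) @[n --> \oo] --> (-1 : R).
  apply: fcvg => // y; near=> n; apply: itv_mean_cst => // r rd.
  apply: unit_clamp_leN1; rewrite linearZ phi_split.
  have := phi_s r rd; have : 1 + M * `|y| <= n%:R * q by near: n.
  have := phi_le r y; rewrite ler_norml => /andP[_ +].
  have : 0 <= n%:R :> R by []; move: (phi r y : R) (phi r _ - _) => p w.
  by move=> ? ? ? ?; nra.
have /cvgrPdist_le fts : ou_semigroup S mu t (f n) (n%:R *: x0) -
    ou_semigroup S mu s (f n) (n%:R *: x0) @[n --> \oo] --> (1 - -1 : R).
  exact: cvgB ft fs.
(* Lower bound up to [e]: the differences evaluated at [n *: x0] tend to [1 - (-1) = 2], and each is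
   bounded by the operator norm. *)
apply/lee_addgt0Pr => e e0.
near \oo => n.
have : `|1 - -1 - (ou_semigroup S mu t (f n) (n%:R *: x0) -
    ou_semigroup S mu s (f n) (n%:R *: x0))| <= e.
  by near: n; exact: fts.
rewrite ler_norml => /andP[_ le_e].
have op_ge := @opnorm_on_ge _ _ _
  (fun g => ou_semigroup S mu t g \- ou_semigroup S mu s g) _
  (n%:R *: x0) (fcirc n) (f1 n).
apply: le_trans (leeD op_ge (lexx e%:E)).
rewrite -EFinD lee_fin /=; apply: le_trans (lerD (ler_norm _) (lexx _)).
move: le_e; rewrite opprK; lra.
Unshelve. all: by end_near. Qed.
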